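(* Let $N\in\mathbb{N}$, $N\ge 1$. For any set $X=\{x_1<x_2<\dots<x_N\}\subset(0,1)$ and any $\varepsilon>0$, the Lebesgue function $\Lambda_{1,\varepsilon,X}$ satisfies $\Lambda_{1,\varepsilon,X}(x)<1$ for all $x\in(0,1)\setminus X$, $\Lambda_{1,\varepsilon,X}(x)=1$ for all $x\in X$, and $$\lim_{x\to0}\Lambda_{1,\varepsilon,X}(x)=\lim_{x\to1}\Lambda_{1,\varepsilon,X}(x)=0,$$ where the limits are taken within $(0,1)$.
   Context: For $\varepsilon>0$ the Brownian Bridge kernel $k_{1,\varepsilon}:(0,1)^2\to\mathbb{R}$ is $$k_{1,\varepsilon}(x,y)=\frac{\sinh(\varepsilon\min(x,y))\,\sinh(\varepsilon(1-\max(x,y)))}{\varepsilon\sinh(\varepsilon)},\quad x,y\in(0,1).$$ It is strictly positive definite on $(0,1)$. The cardinal (Lagrange) basis of $V_{1,\varepsilon}(X)=\operatorname{span}\{k_{1,\varepsilon}(\cdot,x):x\in X\}$ is the family of unique elements $\ell_{1,\varepsilon,i}\in V_{1,\varepsilon}(X)$, $1\le i\le N$, with $\ell_{1,\varepsilon,i}(x_j)=\delta_{ij}$ for $1\le i,j\le N$. The Lebesgue function is $\Lambda_{1,\varepsilon,X}(x):=\sum_{i=1}^N|\ell_{1,\varepsilon,i}(x)|$ for $x\in(0,1)$. *)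

(* Defs.v *)
From HB Require Import structures.
From mathcomp Require Import all_boot all_order all_algebra.
From mathcomp Require Import all_classical all_reals all_analysis.
From mathcomp Require Import ring.
Set Implicit Arguments.
Unset Strict Implicit.
Unset Printing Implicit Defensive.
Import Order.TTheory GRing.Theory Num.Theory.
Import numFieldNormedType.Exports.
Local Open Scope classical_set_scope.
Local Open Scope ring_scope.

Definition sinh {R : realType} (x : R) : R := (expR x - expR (- x)) / 2.

(* Only meant for x, y in ]0, 1[; outside that square the same formula is used
   as an irrelevant extension. *)
Definition bb_kernel {R : realType} (eps x y : R) : R :=
  sinh (eps * Num.min x y) * sinh (eps * (1 - Num.max x y)) /
  (eps * sinh eps).

Definition bb_space {R : realType} (eps : R) {N : nat} (X : 'I_N -> R) :
    set (R -> R) :=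
  [set f | exists c : 'I_N -> R,
     f = fun x => \sum_(j < N) c j * bb_kernel eps x (X j)].

Definition is_cardinal {R : realType} (eps : R) {N : nat} (X : 'I_N -> R)
    (i : 'I_N) : set (R -> R) :=
  [set f | bb_space eps X f /\ forall j : 'I_N, f (X j) = (i == j)%:R].

(* [get] picks an element of a nonempty set; for eps > 0 and strictly ordered
   nodes in ]0, 1[ that element exists and is unique, see
   [is_cardinal_exists_unique] below. *)
Definition cardinal {R : realType} (eps : R) {N : nat} (X : 'I_N -> R)
    (i : 'I_N) : R -> R :=
  get (is_cardinal eps X i).

Definition lebesgue_function {R : realType} (eps : R) {N : nat}
    (X : 'I_N -> R) (x : R) : R :=
  \sum_(i < N) `|cardinal eps X i x|.

Section WellDefined.
Variable R : realType.
Implicit Types (eps x y a b : R).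

Lemma sinh_lt x y : x < y -> sinh x < sinh y.
Proof.
move=> xy; rewrite /sinh ltr_pM2r ?invr_gt0 ?ltr0n//.
by apply: ltrB; rewrite ltr_expR ?ltrN2.
Qed.

Lemma sinh_gt0 x : 0 < x -> 0 < sinh x.
Proof. by move=> /sinh_lt; rewrite {1}/sinh oppr0 subrr mul0r. Qed.

Lemma bb_kernelC eps x y : bb_kernel eps x y = bb_kernel eps y x.
Proof. by rewrite /bb_kernel minC maxC. Qed.

Lemma bb_kernel_le eps x y : x <= y ->
  bb_kernel eps x y = sinh (eps * x) * sinh (eps * (1 - y)) / (eps * sinh eps).
Proof. by move=> xy; rewrite /bb_kernel (min_idPl xy) (max_idPr xy). Qed.

Lemma sinh_wronskian_gt0 eps a b : 0 < eps -> 0 < a -> a < b -> b < 1 ->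
  sinh (eps * a) * sinh (eps * (1 - b)) < sinh (eps * b) * sinh (eps * (1 - a)).
Proof.
move=> e0 a0 ab b1; apply: ltr_pM.
- by apply/ltW/sinh_gt0/mulr_gt0.
- by apply/ltW/sinh_gt0/mulr_gt0; rewrite ?subr_gt0.
- by apply: sinh_lt; rewrite ltr_pM2l.
- by apply: sinh_lt; rewrite ltr_pM2l// ltrD2l ltrN2.
Qed.

Section Nodes.
Variables (eps : R) (N : nat) (X : 'I_N -> R).
Hypothesis eps_gt0 : 0 < eps.
Hypothesis X01 : forall i, 0 < X i < 1.
Hypothesis Xlt : forall i j : 'I_N, (i < j)%N -> X i < X j.

Let u (i : 'I_N) := sinh (eps * X i).
Let v (i : 'I_N) := sinh (eps * (1 - X i)).
Let w := eps * sinh eps.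

Let u_gt0 i : 0 < u i.
Proof. by apply/sinh_gt0/mulr_gt0 => //; case/andP: (X01 i). Qed.

Let v_gt0 i : 0 < v i.
Proof. by apply/sinh_gt0/mulr_gt0; rewrite ?subr_gt0//; case/andP: (X01 i). Qed.

Let w_gt0 : 0 < w. Proof. by apply: mulr_gt0 => //; exact: sinh_gt0. Qed.

Let Xle (i j : 'I_N) : (i <= j)%N -> X i <= X j.
Proof.
rewrite leq_eqVlt => /predU1P[/val_inj ->//|ij]; exact/ltW/Xlt.
Qed.

Let kE (i j : 'I_N) : (i <= j)%N ->
  bb_kernel eps (X i) (X j) = u i * v j / w.
Proof. by move=> /Xle; exact: bb_kernel_le. Qed.

Lemma bb_kernel_free (c : 'I_N -> R) :
  (forall i, \sum_(j < N) c j * bb_kernel eps (X i) (X j) = 0) ->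
  forall i, c i = 0.
Proof.
move=> c0 i; have [m im] := ubnP (val i).
elim: m i im => // m IH i im.
have cb (j : 'I_N) : (j < i)%N -> c j = 0.
  by move=> ji; apply: IH; rewrite (leq_trans ji).
have Si : \sum_(j < N | (i <= j)%N) c j * v j = 0.
  have := c0 i; rewrite (bigID (fun j : 'I_N => (i <= j)%N)) /=.
  rewrite [X in _ + X]big1 ?addr0; last first.
    by move=> j; rewrite -ltnNge => /cb ->; rewrite mul0r.
  rewrite (eq_bigr (fun j => (u i / w) * (c j * v j))); last first.
    by move=> j ij; rewrite kE//; ring.
  rewrite -mulr_sumr => /eqP; rewrite mulf_eq0 => /orP[|/eqP//].
  by rewrite gt_eqF// divr_gt0.
rewrite (bigD1 i)//= in Si.
have [iN|Ni] := ltnP i.+1 N; last first.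
  rewrite big1 ?addr0 in Si; last first.
    move=> j /andP[ij ji]; suff : (i.+1 < N)%N by rewrite ltnNge Ni.
    by apply: leq_ltn_trans (ltn_ord j); rewrite ltn_neqAle ij eq_sym ji.
  by move/eqP: Si; rewrite mulf_eq0 (gt_eqF (v_gt0 i)) orbF => /eqP.
pose n := Ordinal iN.
have := c0 n; rewrite (bigID (fun j : 'I_N => (i <= j)%N)) /=.
rewrite [X in _ + X]big1 ?addr0; last first.
  by move=> j; rewrite -ltnNge => /cb ->; rewrite mul0r.
rewrite (bigD1 i)//= bb_kernelC kE//.
rewrite (eq_bigr (fun j => (u n / w) * (c j * v j))); last first.
  move=> j /andP[ij ji]; rewrite kE; first by ring.
  by rewrite ltn_neqAle ij eq_sym ji.
move/eqP: Si; rewrite addrC addr_eq0 => /eqP Si.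
rewrite -mulr_sumr Si => /eqP.
have -> : c i * (u i * v n / w) + u n / w * - (c i * v i) =
    c i * ((u i * v n - u n * v i) / w) by ring.
rewrite mulf_eq0 => /orP[/eqP//|].
rewrite mulf_eq0 invr_eq0 (gt_eqF w_gt0) orbF subr_eq0 lt_eqF//.
have /andP[Xi0 _] := X01 i; have /andP[_ Xn1] := X01 n.
by apply: sinh_wronskian_gt0 => //; apply: Xlt => /=.
Qed.

Lemma is_cardinal_exists_unique (i : 'I_N) : exists! f, is_cardinal eps X i f.
Proof.
pose K := \matrix_(i < N, j < N) bb_kernel eps (X i) (X j).
have KU : K \in unitmx.
  rewrite unitmxE unitfE; apply/det0P => -[c /negP c0 cK]; apply: c0.
  apply/eqP/rowP => j; rewrite mxE.
  apply: (bb_kernel_free (c := fun j => c 0 j)) => k.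
  have /rowP/(_ k) := cK; rewrite !mxE => ck; rewrite -[RHS]ck.
  by apply: eq_bigr => l _; rewrite mxE bb_kernelC.
exists (fun x => \sum_(j < N) invmx K i j * bb_kernel eps x (X j)); split.
  split; first by exists (invmx K i).
  move=> j; have /matrixP/(_ i j) := mulVmx KU; rewrite !mxE => KV; rewrite -[RHS]KV.
  by apply: eq_bigr => l _; rewrite mxE bb_kernelC.
move=> _ [[c ->] cX].
suff cE j : invmx K i j - c j = 0.
  apply/funext => x; apply: eq_bigr => j _.
  by move/eqP: (cE j); rewrite subr_eq0 => /eqP ->.
apply: (bb_kernel_free (c := fun j => invmx K i j - c j)) => k.
under eq_bigr do rewrite mulrBl.
rewrite sumrB cX; have /matrixP/(_ i k) := mulVmx KU; rewrite !mxE => <-.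
apply/eqP; rewrite subr_eq0; apply/eqP.
by apply: eq_bigr => l _; rewrite mxE bb_kernelC.
Qed.

Lemma cardinalP (i : 'I_N) : is_cardinal eps X i (cardinal eps X i).
Proof.
by have [f [fP _]] := is_cardinal_exists_unique i; apply: getPex; exists f.
Qed.

End Nodes.
End WellDefined.

(* Main.v *)
Require Import Defs.
From mathcomp Require Import all_boot all_order all_algebra.
From mathcomp Require Import all_classical all_reals all_analysis.
From mathcomp Require Import ring.
Import Order.TTheory GRing.Theory Num.Theory.
Import numFieldNormedType.Exports.
Local Open Scope classical_set_scope.
Local Open Scope ring_scope.

(* Every f in the span satisfies the two-point interpolation formula of the
   solutions of g'' = eps^2 g on an interval [a, b] free of interior nodes, and
   vanishes at 0 and 1.  So 0 and 1 act as extra nodes with zero data: for x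
   between adjacent nodes a < b,
     Lambda(x) <= (Lambda(a) sinh(eps (b - x)) + Lambda(b) sinh(eps (x - a)))
                    / sinh(eps (b - a)),
   where Lambda(a), Lambda(b) <= 1, and strict superadditivity of sinh makes
   the right-hand side smaller than 1.  The limits are Lambda(0) = Lambda(1) = 0
   by continuity. *)

Section BrownianBridge.
Set Implicit Arguments.
Unset Strict Implicit.
Context {R : realType}.
Implicit Types (eps x y a b : R).

Lemma sinh0 : sinh 0 = 0 :> R.
Proof. by rewrite /sinh oppr0 subrr mul0r. Qed.

Lemma continuous_sinh : continuous (sinh : R -> R).
Proof.
move=> x; apply: cvgMr_tmp; apply: cvgB; first exact: continuous_expR.
apply: cvg_comp; last exact: continuous_expR.
by apply: cvgN; exact: cvg_id.
Qed.

(** Multiplied by 2, the gap factors as $(e^x-1)(e^y-1)(1-e^{-x-y})$, and each factor is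
    positive. *)
Lemma sinhD_gt x y : 0 < x -> 0 < y -> sinh x + sinh y < sinh (x + y).
Proof.
move=> x0 y0; have A1 : 1 < expR x by rewrite expR_gt1.
have B1 : 1 < expR y by rewrite expR_gt1.
have A0 := expR_gt0 x; have B0 := expR_gt0 y.
rewrite -subr_gt0 /sinh opprD !expRD !expRN.
have -> : (expR x * expR y - (expR x)^-1 * (expR y)^-1) / 2 -
    ((expR x - (expR x)^-1) / 2 + (expR y - (expR y)^-1) / 2) =
  (expR x - 1) * (expR y - 1) * (1 - (expR x)^-1 * (expR y)^-1) / 2.
  by field; rewrite !gt_eqF.
rewrite divr_gt0// !mulr_gt0 ?subr_gt0// -invfM invf_lt1 ?mulr_gt0//.
by rewrite mulr_egt1.
Qed.

(** Three-term Plücker relation for the points $0,x,y,z$: $\sinh(p-q)$ is the determinant of $(\sinh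
    p,\cosh p)$ and $(\sinh q,\cosh q)$. *)
Lemma sinh_plucker x y z :
  sinh x * sinh (z - y) = sinh y * sinh (z - x) + sinh z * sinh (x - y).
Proof.
have A0 := expR_gt0 x; have B0 := expR_gt0 y; have C0 := expR_gt0 z.
rewrite /sinh !opprD !opprK !expRD !expRN.
by field; rewrite !gt_eqF.
Qed.

(** The endpoints lie outside the kernel's domain, but its formula extends continuously to them;
    this turns the boundary limits into values. *)
Lemma bb_kernel0l eps y : 0 <= y -> bb_kernel eps 0 y = 0.
Proof. by move=> y0; rewrite bb_kernel_le// mulr0 sinh0 !mul0r. Qed.

Lemma bb_kernel1l eps y : y <= 1 -> bb_kernel eps 1 y = 0.
Proof.
by move=> y1; rewrite bb_kernelC bb_kernel_le// subrr mulr0 sinh0 mulr0 mul0r.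
Qed.

Lemma continuous_bb_kernel eps y : continuous (fun x => bb_kernel eps x y).
Proof.
move=> x; apply: cvgMr_tmp; apply: cvgM;
  (apply: cvg_comp; last exact: continuous_sinh); apply: cvgMl_tmp.
- by apply: continuous_min; [exact: cvg_id | exact: cvg_cst].
- apply: cvgB; first exact: cvg_cst.
  by apply: continuous_max; [exact: cvg_id | exact: cvg_cst].
Qed.

(** With [y] outside the open interval, [min] and [max] resolve the same way at [a], [x] and [b]. Up
    to a common factor the kernel is then $\sinh(\varepsilon(1-\cdot))$ or
    $\sinh(\varepsilon\,\cdot)$, and the Plücker relation applies. *)
Lemma bb_kernel_interp eps y a b x : a <= x -> x <= b -> y <= a \/ b <= y ->
  bb_kernel eps x y * sinh (eps * (b - a)) =
  bb_kernel eps a y * sinh (eps * (b - x)) +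
  bb_kernel eps b y * sinh (eps * (x - a)).
Proof.
move=> ax xb [ya|By].
- rewrite !(bb_kernelC _ _ y) !bb_kernel_le ?(le_trans ya)//; last exact: le_trans xb.
  (* The reflection $t\mapsto 1-t$ reverses order, so [b] and [a] trade places. *)
  have := sinh_plucker (eps * (1 - x)) (eps * (1 - b)) (eps * (1 - a)).
  have -> : eps * (1 - a) - eps * (1 - b) = eps * (b - a) by ring.
  have -> : eps * (1 - a) - eps * (1 - x) = eps * (x - a) by ring.
  have -> : eps * (1 - x) - eps * (1 - b) = eps * (b - x) by ring.
  move=> H; rewrite [LHS](_ : _ = sinh (eps * (1 - x)) * sinh (eps * (b - a)) *
    (sinh (eps * y) / (eps * sinh eps))); first by rewrite H; ring.
  by ring.
- rewrite !bb_kernel_le ?(le_trans xb)//; last exact: le_trans (le_trans ax xb) By.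
  have := sinh_plucker (eps * x) (eps * a) (eps * b).
  rewrite -!mulrBr => H.
  rewrite [LHS](_ : _ = sinh (eps * x) * sinh (eps * (b - a)) *
    (sinh (eps * (1 - y)) / (eps * sinh eps))); first by rewrite H; ring.
  by ring.
Qed.

Section Space.
Variables (eps : R) (N : nat) (X : 'I_N -> R) (f : R -> R).
Hypothesis fX : bb_space eps X f.

Lemma bb_space_continuous : continuous f.
Proof.
case: fX => c ->; apply: continuous_big => [|j _ x]; first exact: add_continuous.
by apply: cvgMl_tmp; exact: continuous_bb_kernel.
Qed.

Lemma bb_space0 : (forall j, 0 <= X j) -> f 0 = 0.
Proof.
by case: fX => c -> X0; rewrite big1// => j _; rewrite bb_kernel0l ?mulr0.
Qed.

Lemma bb_space1 : (forall j, X j <= 1) -> f 1 = 0.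
Proof.
by case: fX => c -> X1; rewrite big1// => j _; rewrite bb_kernel1l ?mulr0.
Qed.

Lemma bb_space_interp a b x : a <= x -> x <= b ->
  (forall j, X j <= a \/ b <= X j) ->
  f x * sinh (eps * (b - a)) =
  f a * sinh (eps * (b - x)) + f b * sinh (eps * (x - a)).
Proof.
case: fX => c -> ax xb Xab; rewrite !mulr_suml -big_split/=.
apply: eq_bigr => j _; rewrite -3!(mulrA (c j)) -mulrDr.
by rewrite (bb_kernel_interp eps ax xb (Xab j)).
Qed.

End Space.

Section Lebesgue.
Variables (eps : R) (N : nat) (X : 'I_N -> R).
Hypothesis eps_gt0 : 0 < eps.
Hypothesis X01 : forall i, 0 < X i < 1.
Hypothesis Xlt : forall i j : 'I_N, (i < j)%N -> X i < X j.

Let cardinalX i : is_cardinal eps X i (cardinal eps X i).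
Proof. exact: cardinalP. Qed.

Lemma lebesgue_function_node i : lebesgue_function eps X (X i) = 1.
Proof.
rewrite /lebesgue_function (bigD1 i)//= big1 => [|j ji].
  by rewrite (cardinalX i).2 eqxx normr1 addr0.
by rewrite (cardinalX j).2 (negbTE ji) normr0.
Qed.

Lemma lebesgue_function0 : lebesgue_function eps X 0 = 0.
Proof.
apply: big1 => i _; rewrite (bb_space0 (cardinalX i).1) ?normr0// => j.
by case/andP: (X01 j) => /ltW.
Qed.

Lemma lebesgue_function1 : lebesgue_function eps X 1 = 0.
Proof.
apply: big1 => i _; rewrite (bb_space1 (cardinalX i).1) ?normr0// => j.
by case/andP: (X01 j) => _ /ltW.
Qed.

Lemma continuous_lebesgue_function : continuous (lebesgue_function eps X).
Proof.
apply: continuous_big => [|i _ x]; first exact: add_continuous.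
apply: cvg_norm.
exact: bb_space_continuous (cardinalX i).1 x.
Qed.

Lemma lebesgue_function_interp a b x : a < x -> x < b ->
  (forall j, X j <= a \/ b <= X j) ->
  lebesgue_function eps X x * sinh (eps * (b - a)) <=
  lebesgue_function eps X a * sinh (eps * (b - x)) +
  lebesgue_function eps X b * sinh (eps * (x - a)).
Proof.
move=> ax xb Xab.
have sp y z : y < z -> 0 <= sinh (eps * (z - y)).
  by move=> yz; rewrite ltW// sinh_gt0// mulr_gt0// subr_gt0.
rewrite !mulr_suml -big_split/=; apply: ler_sum => i _.
(* The positive weight moves inside the absolute value, so that the interpolation formula applies to
   each cardinal function before the triangle inequality. *)
rewrite -[sinh _ in leLHS]ger0_norm ?sp ?(lt_trans ax)// -normrM.
rewrite (bb_space_interp (cardinalX i).1 (ltW ax) (ltW xb) Xab).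
rewrite (le_trans (ler_normD _ _))// 2!(normrM (cardinal _ _ _ _)).
by rewrite (ger0_norm (sp _ _ xb)) (ger0_norm (sp _ _ ax)).
Qed.

(** The default 0 of the maximum is the artificial node, selected when no node lies to the left of
    [x]. *)
Lemma left_neighbour x : 0 < x -> exists a,
  [/\ a < x, a = 0 \/ range X a & forall j, X j < x -> X j <= a].
Proof.
move=> x0; exists (\big[Num.max/0]_(j | X j < x) X j).
have [ax aX] : \big[Num.max/0]_(j | X j < x) X j < x /\
    (\big[Num.max/0]_(j | X j < x) X j = 0 \/
     range X (\big[Num.max/0]_(j | X j < x) X j)).
  (* A maximum of two values is one of them, so both properties pass to the big maximum. *)
  apply: (big_ind (fun a => a < x /\ (a = 0 \/ range X a))).
  - by split=> //; left.
  - by move=> y z ? ?; case: (leP y z).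
  - by move=> j xj; split=> //; right; exists j.
by split=> // j xj; exact: le_bigmax_cond.
Qed.

Lemma right_neighbour x : x < 1 -> exists b,
  [/\ x < b, b = 1 \/ range X b & forall j, x < X j -> b <= X j].
Proof.
move=> x1; exists (\big[Num.min/1]_(j | x < X j) X j).
have [xb bX] : x < \big[Num.min/1]_(j | x < X j) X j /\
    (\big[Num.min/1]_(j | x < X j) X j = 1 \/
     range X (\big[Num.min/1]_(j | x < X j) X j)).
  apply: (big_ind (fun b => x < b /\ (b = 1 \/ range X b))).
  - by split=> //; left.
  - by move=> y z ? ?; case: (leP y z).
  - by move=> j xj; split=> //; right; exists j.
by split=> // j xj; exact: bigmin_le_cond.
Qed.

Lemma lebesgue_function_lt1 x : 0 < x < 1 -> ~ range X x ->
  lebesgue_function eps X x < 1.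
Proof.
move=> /andP[x0 x1] xX.
have [a [ax aX Xa]] := left_neighbour x0.
have [b [xb bX Xb]] := right_neighbour x1.
(* The value is 0 at an artificial node and 1 at a true one. *)
have La : lebesgue_function eps X a <= 1.
  case: aX => [->|[i _ <-]]; first by rewrite lebesgue_function0.
  by rewrite lebesgue_function_node.
have Lb : lebesgue_function eps X b <= 1.
  case: bX => [->|[i _ <-]]; first by rewrite lebesgue_function1.
  by rewrite lebesgue_function_node.
have Xab j : X j <= a \/ b <= X j.
  case: (ltgtP (X j) x) => [/Xa|/Xb|jx]; [by left | by right |].
  by case: xX; exists j.
have s_gt0 y z : y < z -> 0 < sinh (eps * (z - y)).
  by move=> yz; rewrite sinh_gt0// mulr_gt0// subr_gt0.
rewrite -(ltr_pM2r (s_gt0 _ _ (lt_trans ax xb))) mul1r.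
apply: le_lt_trans (lebesgue_function_interp ax xb Xab) _.
apply: (@le_lt_trans _ _ (sinh (eps * (b - x)) + sinh (eps * (x - a)))).
  by apply: lerD; rewrite ler_piMl// ltW// s_gt0.
have -> : eps * (b - a) = eps * (b - x) + eps * (x - a) by ring.
by apply: sinhD_gt; rewrite mulr_gt0// subr_gt0.
Qed.

End Lebesgue.
End BrownianBridge.

Theorem theorem3 (R : realType) (N : nat) (hN : (1 <= N)%N)
    (X : 'I_N -> R)
    (hX01 : forall i : 'I_N, 0 < X i < 1)
    (hX : forall i j : 'I_N, (i < j)%N -> X i < X j)
    (eps : R) (heps : 0 < eps) :
  [/\ forall x : R, 0 < x < 1 -> ~ range X x ->
        lebesgue_function eps X x < 1,
      forall x : R, range X x -> lebesgue_function eps X x = 1,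
      lebesgue_function eps X x @[x --> within `]0, 1[ (nbhs (0 : R))] -->
        (0 : R)
    & lebesgue_function eps X x @[x --> within `]0, 1[ (nbhs (1 : R))] -->
        (0 : R)].
Proof.
have L := continuous_lebesgue_function heps hX01 hX.
split.
- by move=> x; exact: lebesgue_function_lt1.
- by move=> _ [i _ <-]; exact: lebesgue_function_node.
(* The target 0 is rewritten as the value at the endpoint; continuity on the whole line then
   restricts to []0, 1[]. *)
- by rewrite -[X in _ --> X](lebesgue_function0 heps hX01 hX); exact: cvg_within_filter (L 0).
- by rewrite -[X in _ --> X](lebesgue_function1 heps hX01 hX); exact: cvg_within_filter (L 1).
Qed.
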